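(* Let $n,m\ge0$ be integers. Then: (1) As formal power series in $x$, $\dfrac{l^{a}(a+m)^k}{a^k}\operatorname{Lif}_k\!\Big(-\dfrac{l\ln(1+qx)}{q};a+m\Big)=\sum_{n\ge0}\widehat{\mathcal{C}}_{n,m}^{(k)}(a,q,L)\dfrac{x^n}{n!}$. (2) $\widehat{\mathcal{C}}_{n,m}^{(k)}(a,q,L)=\dfrac{(a+m)^k}{a^k}\sum_{i=0}^n q^{n-i}s(n,i)\dfrac{(-1)^i l^{a+i}}{(a+i+m)^k}$. (3) $\widehat{\mathcal{C}}_{n,m}^{(k)}(a,q,L)=\dfrac{(-q)^m(a+m)^k}{l^m a^k}\sum_{j=0}^m q^{-j}\left\{ {m+n \atop j+n} \right\}_n\widehat{c}_{n+j}^{(k)}(a,q,L)$. (4) $\widehat{\mathcal{C}}_{n+1,m}^{(k)}(a,q,L)=-l\Big(1-\dfrac{1}{a+m+1}\Big)^k\widehat{\mathcal{C}}_{n,m+1}^{(k)}(a,q,L)-nq\,\widehat{\mathcal{C}}_{n,m}^{(k)}(a,q,L)$, with $\widehat{\mathcal{C}}_{0,m}^{(k)}(a,q,L)=\dfrac{l^a}{a^k}$. (5) For integers $k\ge0$: $\widehat{\mathcal{C}}_{n+1,m}^{(-k)}(a,q,L)=-l\Big(1+\dfrac{1}{a+m}\Big)^k\widehat{\mathcal{C}}_{n,m+1}^{(-k)}(a,q,L)-nq\,\widehat{\mathcal{C}}_{n,m}^{(-k)}(a,q,L)$, with $\widehat{\mathcal{C}}_{0,m}^{(-k)}(a,q,L)=a^k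 l^a$. (6) As formal power series in $x,y$: $\sum_{n,k\ge0}\widehat{\mathcal{C}}_{n,m}^{(-k)}(a,q,L)\dfrac{x^n}{n!}\dfrac{y^k}{k!}=\dfrac{l^a e^{ay}}{(1+qx)^{\frac{l}{q}e^{\frac{ay}{a+m}}}}$.
   Context: Let $a,q,l$ be nonzero reals (with $l=\prod_{i=1}^k l_i$ for $L=(l_1,\dots,l_k)$ nonzero reals); denominators $a+j$ ($j\ge0$ integer) are assumed nonzero and $l^{a+i}$ means $l^a l^i$. Let $s(n,i)$ be the signed Stirling numbers of the first kind ($\frac{1}{i!}(\ln(1+x))^i=\sum_{n\ge i}s(n,i)\frac{x^n}{n!}$) and let the $r$-Stirling numbers of the second kind be defined by $\sum_{n\ge i}\left\{ {n+r \atop i+r} \right\}_r\frac{z^n}{n!}=\frac{1}{i!}e^{rz}(e^z-1)^i$. For an integer $k$ (of either sign) define the generalized poly-Cauchy numbers of the second kind $\widehat{c}_n^{(k)}(a,q,L)=\sum_{i=0}^n s(n,i)(-1)^i\frac{q^{n-i}l^{a+i}}{(a+i)^k}$ and the generalized $m$-poly-Cauchy numbers of the second kind \[ \widehat{\mathcal{C}}_{n,m}^{(k)}(a,q,L)=\frac{(a+m)^k}{a^k}\sum_{i=0}^n q^{n-i}s(n,i)\frac{(-1)^i l^{a+i}}{(a+i+m)^k} \] (so $\widehat{\mathcal{C}}_{n,m}^{(-k)}$ is this expression with $k$ replaced by $-k$). Here $\operatorname{Lif}_k(z;b)=\sum_{n\ge0}\frac{1}{(n+b)^k}\frac{z^n}{n!}$.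 In parts (1)–(4), $k\ge1$. *)

(* Defs.v *)
From HB Require Import structures.
From mathcomp Require Import all_boot all_order all_algebra.
From mathcomp Require Import boolp reals exp trigo.
From mathcomp Require Import complex.

Set Implicit Arguments.
Unset Strict Implicit.
Unset Printing Implicit Defensive.

Import Order.TTheory GRing.Theory Num.Theory.

Local Open Scope ring_scope.
Local Open Scope complex_scope.

Record fps (A : Type) := Fps { fcoef : nat -> A }.

Notation "{ 'fps' A }" := (fps A) (at level 0, format "{ 'fps'  A }").
Notation "\fps_ n E" := (Fps (fun n : nat => E))
  (at level 36, n name, E at level 36, format "\fps_ n  E").

Lemma fpsP (A : Type) (f g : {fps A}) : (forall n, fcoef f n = fcoef g n) -> f = g.
Proof. by case: f => f; case: g => g /= fg; congr Fps; apply/funext. Qed.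

HB.instance Definition _ (A : Type) := gen_eqMixin {fps A}.
HB.instance Definition _ (A : Type) := gen_choiceMixin {fps A}.

Section FpsZmodule.
Variable A : zmodType.
Implicit Types f g h : {fps A}.

Definition fps0 : {fps A} := \fps_n 0.
Definition fps_opp f : {fps A} := \fps_n (- fcoef f n).
Definition fps_add f g : {fps A} := \fps_n (fcoef f n + fcoef g n).

Fact fps_addA : associative fps_add.
Proof. by move=> f g h; apply: fpsP => n /=; rewrite addrA. Qed.
Fact fps_addC : commutative fps_add.
Proof. by move=> f g; apply: fpsP => n /=; rewrite addrC. Qed.
Fact fps_add0 : left_id fps0 fps_add.
Proof. by move=> f; apply: fpsP => n /=; rewrite add0r. Qed.
Fact fps_addN : left_inverse fps0 fps_opp fps_add.
Proof. by move=> f; apply: fpsP => n /=; rewrite addNr. Qed.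

HB.instance Definition _ :=
  GRing.isZmodule.Build {fps A} fps_addA fps_addC fps_add0 fps_addN.
End FpsZmodule.

Section FpsRing.
Variable A : comNzRingType.
Implicit Types f g h : {fps A}.

Definition fpsC (c : A) : {fps A} := \fps_n (if n == 0%N then c else 0).
Definition fpsX : {fps A} := \fps_n (n == 1%N)%:R.
Definition fps_mul f g : {fps A} :=
  \fps_n (\sum_(i < n.+1) fcoef f i * fcoef g (n - i)).

Let trunc N f : {poly A} := \poly_(i < N) fcoef f i.

Let truncM N f g i : (i < N)%N ->
  (trunc N f * trunc N g)`_i = fcoef (fps_mul f g) i.
Proof.
move=> ltiN; rewrite coefM; apply: eq_bigr => j _.
have -> : (trunc N f)`_j = fcoef f j.
  by rewrite coef_poly (leq_ltn_trans _ ltiN) // -ltnS.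
have -> // : (trunc N g)`_(i - j) = fcoef g (i - j).
by rewrite coef_poly (leq_ltn_trans (leq_subr _ _) ltiN).
Qed.

Fact fps_mulC : commutative fps_mul.
Proof.
by move=> f g; apply: fpsP => n; rewrite -!(@truncM n.+1) // mulrC.
Qed.

Fact fps_mulA : associative fps_mul.
Proof.
move=> f g h; apply: fpsP => n.
transitivity ((trunc n.+1 f * (trunc n.+1 g * trunc n.+1 h))`_n).
  rewrite coefM; apply: eq_bigr => i _.
  by rewrite coef_poly ltn_ord truncM // ltnS leq_subr.
rewrite mulrA coefM; apply: eq_bigr => i _.
by rewrite truncM // coef_poly ltnS leq_subr.
Qed.

Fact fps_mul1 : left_id (fpsC 1) fps_mul.
Proof.
move=> f; apply: fpsP => n /=; rewrite big_ord_recl /= mul1r subn0.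
by rewrite big1 ?addr0 // => i _; rewrite mul0r.
Qed.

Fact fps_mulDl : left_distributive fps_mul +%R.
Proof.
move=> f g h; apply: fpsP => n /=; rewrite -big_split /=.
by apply: eq_bigr => i _; rewrite mulrDl.
Qed.

Fact fps_1_neq0 : fpsC 1 != 0.
Proof.
by apply/eqP => /(congr1 (fun f => fcoef f 0)) /= /eqP; rewrite oner_eq0.
Qed.

HB.instance Definition _ := GRing.Zmodule_isComNzRing.Build {fps A}
  fps_mulA fps_mulC fps_mul1 fps_mulDl fps_1_neq0.

(* The inverse is chosen classically; it is the usual one whenever it exists. *)
Definition fps_unit : {pred {fps A}} := fun f => `[< exists g, g * f = 1 >].
Definition fps_inv f : {fps A} :=
  if pselect (exists g, g * f = 1) is left ex then projT1 (cid ex) else f.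

Fact fps_mulV : {in fps_unit, left_inverse 1 fps_inv *%R}.
Proof.
move=> f /asboolP ex; rewrite /fps_inv; case: pselect => // ex'.
exact: (projT2 (cid ex')).
Qed.
Fact fps_unitPl f g : g * f = 1 -> fps_unit f.
Proof. by move=> gf; apply/asboolP; exists g. Qed.
Fact fps_inv_out : {in [predC fps_unit], fps_inv =1 id}.
Proof.
move=> f /negP nex; rewrite /fps_inv; case: pselect => // ex.
by case: nex; apply/asboolP.
Qed.

HB.instance Definition _ := GRing.ComNzRing_hasMulInverse.Build {fps A}
  fps_mulV fps_unitPl fps_inv_out.

(* The usual composition f(g(x)) when g has zero constant term; a junk value
   otherwise, since then f(g(x)) need not make sense. *)
Definition fps_comp f g : {fps A} :=
  \fps_n (\sum_(i < n.+1) fcoef f i * fcoef (g ^+ i) n).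
End FpsRing.

Arguments fpsX {A}.

(** The variable [x] is [fpsX]; a series in [x] and [y] is an element of
    [{fps {fps A}}], the outer variable being [x] and the inner one [y]. *)
Section FpsFunctions.
Variable A : comUnitRingType.
Implicit Types f : {fps A}.

Definition fps_exp f : {fps A} := fps_comp (\fps_n (n`!%:R)^-1) f.

(* ln(1 + f), for f with zero constant term *)
Definition fps_ln1p f : {fps A} :=
  fps_comp (\fps_n (if n == 0%N then 0 else (-1) ^+ n.-1 / n%:R)) f.

(* (1 + f)^e with an exponent e not depending on the outer variable *)
Definition fps_pow1p f (e : A) : {fps A} := fps_exp (fpsC e * fps_ln1p f).

(* 1/i! (ln(1+x))^i = sum_n s(n,i) x^n/n! *)
Definition stirling1 (n i : nat) : A :=
  n`!%:R * fcoef (fpsC (i`!%:R)^-1 * fps_ln1p fpsX ^+ i) n.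

(* [rstirling2 r n i] is {n+r, i+r}_r: both entries are shifted by r, as in
   1/i! e^(rz) (e^z - 1)^i = sum_n {n+r, i+r}_r z^n/n! *)
Definition rstirling2 (r n i : nat) : A :=
  n`!%:R * fcoef (fpsC (i`!%:R)^-1 *
                  (fps_exp (fpsC r%:R * fpsX) * (fps_exp fpsX - 1) ^+ i)) n.
End FpsFunctions.

Arguments stirling1 {A}.
Arguments rstirling2 {A}.

Definition Lif (F : fieldType) (k : int) (b : F) (z : {fps F}) : {fps F} :=
  fps_comp (\fps_n (1 / (n%:R + b) ^ k * (1 / n`!%:R))) z.

Section PolyCauchy.
Variable R : realType.

(* l^a for real l and a: the real power if l > 0, and the principal value
   |l|^a e^(i pi a) if l < 0, which is why the numbers below are complex. *)
Definition rcpow (l a : R) : R[i] :=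
  if 0 < l then (powR l a)%:C
  else (powR `|l| a)%:C * (cos (pi * a) +i* sin (pi * a)).

(* l^(a+i) is by convention l^a l^i *)
Definition lpow (l a : R) (i : nat) : R[i] := rcpow l a * l%:C ^+ i.

Definition pcauchy2 (k : int) (a q : R) (L : seq R) (n : nat) : R[i] :=
  let l := \prod_(x <- L) x in
  \sum_(i < n.+1) stirling1 n i * (-1) ^+ i *
    (q%:C ^+ (n - i) * lpow l a i / (a%:C + i%:R) ^ k).

Definition mpcauchy2 (k : int) (a q : R) (L : seq R) (n m : nat) : R[i] :=
  let l := \prod_(x <- L) x in
  (a%:C + m%:R) ^ k / a%:C ^ k *
  \sum_(i < n.+1) q%:C ^+ (n - i) * stirling1 n i *
    ((-1) ^+ i * lpow l a i / (a%:C + i%:R + m%:R) ^ k).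
End PolyCauchy.

(* Main.v *)
From HB Require Import structures.
Require Import Defs.
From mathcomp Require Import all_boot all_order all_algebra.
From mathcomp Require Import reals complex.
From mathcomp Require Import ring zify.

Import GRing.Theory Num.Theory.

Local Open Scope ring_scope.
Local Open Scope complex_scope.

(* Write Λ_n(g) = sum_i s(n,i) g(i) for a sequence g. All the numbers involved
   are values of Λ_n at g(i) = l^a (-l/q)^i / (a+i)^k or one of its shifts.
   The differential equation (1+x) E_{i+1}' = E_i for E_i = ln(1+x)^i/i! says
   that Λ_{n+1}(g) = Λ_n(shift g) - n Λ_n(g), which is (4) and (5). Iterating it
   and comparing with the recurrence of the r-Stirling numbers, itself read off
   from the derivative of e^(rz)(e^z-1)^i/i!, gives
   Λ_n(shift^m g) = sum_j {m+n, j+n}_n Λ_{n+j}(g), which is (3).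
   For (6), a(a+i+m)/(a+m) = a + i a/(a+m), so the sum over k contributes
   e^(ay) (e^(ay/(a+m)))^i and the sum over i is the exponential series of
   -(l/q) e^(ay/(a+m)) ln(1+qx). *)

(** * Formal power series: coefficients, composition and derivative *)

Section Coefficients.
Context {A : comNzRingType}.
Implicit Types (c : A) (f g h : {fps A}).

Lemma fcoefD f g n : fcoef (f + g) n = fcoef f n + fcoef g n.
Proof. by []. Qed.

Lemma fcoefN f n : fcoef (- f) n = - fcoef f n.
Proof. by []. Qed.

Lemma fcoefM f g n :
  fcoef (f * g) n = \sum_(i < n.+1) fcoef f i * fcoef g (n - i).
Proof. by []. Qed.

Lemma fcoef1 n : fcoef (1 : {fps A}) n = (n == 0%N)%:R.
Proof. by rewrite /GRing.one /=; case: eqP. Qed.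

Lemma fcoefMn f k n : fcoef (f *+ k) n = fcoef f n *+ k.
Proof. by elim: k => [|k IHk]; rewrite ?mulr0n // !mulrS fcoefD IHk. Qed.

Lemma fcoefCM c f n : fcoef (fpsC c * f) n = c * fcoef f n.
Proof.
rewrite fcoefM big_ord_recl /= subn0 big1 ?addr0 // => i _.
by rewrite mul0r.
Qed.

Lemma fcoef_sum (I : Type) (r : seq I) (P : pred I) (F : I -> {fps A}) n :
  fcoef (\sum_(i <- r | P i) F i) n = \sum_(i <- r | P i) fcoef (F i) n.
Proof. exact: (big_morph (fun f => fcoef f n)). Qed.

Lemma fcoef0M f g : fcoef (f * g) 0 = fcoef f 0 * fcoef g 0.
Proof. by rewrite fcoefM big_ord1. Qed.

Lemma fcoef0X f i : fcoef (f ^+ i) 0 = fcoef f 0 ^+ i.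
Proof.
by elim: i => [|i IHi]; rewrite ?expr0 ?fcoef1 // !exprS fcoef0M IHi.
Qed.

Fact fpsC_is_zmod_morphism : zmod_morphism (@fpsC A).
Proof.
by move=> x y; apply: fpsP => n; rewrite fcoefD fcoefN /=; case: eqP; rewrite ?subr0.
Qed.

Fact fpsC_is_monoid_morphism : monoid_morphism (@fpsC A).
Proof.
by split=> // x y; apply: fpsP => n; rewrite fcoefCM /=; case: eqP; rewrite ?mulr0.
Qed.

HB.instance Definition _ :=
  GRing.isZmodMorphism.Build A {fps A} (@fpsC A) fpsC_is_zmod_morphism.
HB.instance Definition _ :=
  GRing.isMonoidMorphism.Build A {fps A} (@fpsC A) fpsC_is_monoid_morphism.

Lemma fpsCM c d : fpsC (c * d) = fpsC c * fpsC d.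
Proof. exact: rmorphM. Qed.

Lemma fpsCD c d : fpsC (c + d) = fpsC c + fpsC d.
Proof. exact: rmorphD. Qed.

Lemma fpsC_nat n : fpsC n%:R = n%:R :> {fps A}.
Proof. exact: rmorph_nat. Qed.

(** A series without constant term has order at least 1, so its [i]-th power has order at least
    [i]. *)
Lemma fcoefX_lt g i n : fcoef g 0 = 0 -> (n < i)%N -> fcoef (g ^+ i) n = 0.
Proof.
move=> g0; elim: i n => // i IHi n ltni; rewrite exprS fcoefM big1 // => -[j /= lej] _.
case: j lej => [|j] lej; first by rewrite g0 mul0r.
by rewrite IHi ?mulr0 // subnS; case: n ltni lej => // n; lia.
Qed.

(** Powers of [g] beyond the [n]-th do not reach degree [n], so the sum defining the composite may
    run to any larger bound. The chain rule needs one bound common to all degrees. *)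
Lemma fcoef_comp f g n N : fcoef g 0 = 0 -> (n <= N)%N ->
  fcoef (fps_comp f g) n = \sum_(i < N.+1) fcoef f i * fcoef (g ^+ i) n.
Proof.
move=> g0 lenN; rewrite /= -!(big_mkord xpredT (fun i => fcoef f i * fcoef (g ^+ i) n)).
rewrite [RHS](@big_cat_nat _ _ _ n.+1 0 N.+1) //=.
suff -> : \sum_(n.+1 <= i < N.+1) fcoef f i * fcoef (g ^+ i) n = 0 by rewrite addr0.
by rewrite big_nat big1 // => i /andP[ltni _]; rewrite fcoefX_lt ?mulr0.
Qed.

Definition fps_deriv f : {fps A} := \fps_n (fcoef f n.+1 *+ n.+1).

Lemma fcoef_deriv f n : fcoef (fps_deriv f) n = fcoef f n.+1 *+ n.+1.
Proof. by []. Qed.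

Lemma fps_derivD f g : fps_deriv (f + g) = fps_deriv f + fps_deriv g.
Proof. by apply: fpsP => n; rewrite !(fcoefD, fcoef_deriv) mulrnDl. Qed.

Lemma fps_derivM f g :
  fps_deriv (f * g) = fps_deriv f * g + f * fps_deriv g.
Proof.
apply: fpsP => n; rewrite fcoefD fcoef_deriv !fcoefM.
(* The weight splits as n+1 = i + (n+1-i), one summand for each factor. *)
have -> : (\sum_(i < n.+2) fcoef f i * fcoef g (n.+1 - i)) *+ n.+1 =
   \sum_(i < n.+2) (fcoef f i *+ i) * fcoef g (n.+1 - i) +
   \sum_(i < n.+2) fcoef f i * (fcoef g (n.+1 - i) *+ (n.+1 - i)).
  rewrite -big_split /= -sumrMnl; apply: eq_bigr => -[i /= lei] _.
  by rewrite mulrnAl mulrnAr -mulrnDr subnKC // -ltnS.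
congr (_ + _).
  by rewrite big_ord_recl mulr0n mul0r add0r; apply: eq_bigr.
rewrite big_ord_recr /= subnn mulr0n mulr0 addr0; apply: eq_bigr => -[i /= lei] _.
by rewrite subSn.
Qed.

Lemma fps_deriv1 : fps_deriv 1 = 0.
Proof. by apply: fpsP => n; rewrite /= mul0rn. Qed.

Lemma fps_derivCM c f : fps_deriv (fpsC c * f) = fpsC c * fps_deriv f.
Proof. by apply: fpsP => n; rewrite fcoefCM !fcoef_deriv fcoefCM mulrnAr. Qed.

Lemma fps_derivX f i :
  fps_deriv (f ^+ i.+1) = f ^+ i * fps_deriv f *+ i.+1.
Proof.
elim: i => [|i IHi]; first by rewrite expr1 expr0 mul1r.
rewrite exprS fps_derivM IHi [in RHS]mulrSr -mulrnAr mulrA -exprS.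
by rewrite addrC; congr (_ + _); rewrite ?mulrnAr // mulrC.
Qed.

(** Differentiating term by term, the factor i+1 from the derivative of g^(i+1) is absorbed into the
    coefficient of [fps_deriv f]. *)
Lemma fps_deriv_comp f g : fcoef g 0 = 0 ->
  fps_deriv (fps_comp f g) = fps_deriv g * fps_comp (fps_deriv f) g.
Proof.
move=> g0; apply: fpsP => n.
transitivity (\sum_(i < n.+1) fcoef (fps_deriv f) i * fcoef (fps_deriv g * g ^+ i) n).
  rewrite [LHS]/= big_ord_recl expr0 fcoef1 mulr0 add0r -sumrMnl.
  apply: eq_bigr => i _; rewrite -mulrnAr.
  have -> : fcoef (g ^+ lift ord0 i) n.+1 *+ n.+1 = fcoef (fps_deriv (g ^+ i.+1)) n.
    by [].
  by rewrite fps_derivX fcoefMn mulrnAr -mulrnAl mulrC [_ ^+ _ * _]mulrC mulrC.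
under eq_bigr do rewrite fcoefM mulr_sumr.
rewrite exchange_big [RHS]fcoefM; apply: eq_bigr => j _.
(* The composite is needed in degree n-j only; its sum is extended to n so that both sides run over
   the same indices. *)
rewrite (@fcoef_comp _ _ _ n) ?leq_subr // mulr_sumr.
by apply: eq_bigr => i _; rewrite mulrCA.
Qed.

Lemma fcoef_CX_exp c i n : fcoef ((fpsC c * fpsX) ^+ i) n = (n == i)%:R * c ^+ n.
Proof.
elim: i n => [|i IHi] n; first by rewrite expr0 fcoef1; case: eqP => [->|]; rewrite ?mul0r ?mul1r.
rewrite exprS -mulrA fcoefCM; case: n => [|n]; first by rewrite fcoef0M !mul0r mulr0.
rewrite fcoefM big_ord_recl mul0r add0r big_ord_recl /= big1 => [|j _]; last by rewrite mul0r.
by rewrite mul1r addr0 /bump /= subSS subn0 IHi eqSS exprS mulrCA.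
Qed.

Lemma fcoef_comp_CX f c n : fcoef (fps_comp f (fpsC c * fpsX)) n = c ^+ n * fcoef f n.
Proof.
rewrite /= (bigD1 ord_max) //= fcoef_CX_exp eqxx mul1r mulrC big1 ?addr0 // => i ne_in.
by rewrite fcoef_CX_exp eq_sym (negPf ne_in : (i == n :> nat) = false) mul0r mulr0.
Qed.

(** The substitution of c x for x, read on coefficients, respects products because c^n = c^j
    c^(n-j). *)
Lemma fcoef_scaleX f g c i : (forall n, fcoef g n = c ^+ n * fcoef f n) ->
  forall n, fcoef (g ^+ i) n = c ^+ n * fcoef (f ^+ i) n.
Proof.
move=> gE; elim: i => [|i IHi] n.
  by rewrite !expr0 fcoef1; case: n => [|n]; rewrite ?mulr0 ?mul1r.
rewrite !exprS !fcoefM mulr_sumr; apply: eq_bigr => -[j /= lej] _.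
by rewrite gE IHi mulrACA -exprD subnKC.
Qed.
End Coefficients.

(** * Exponential and logarithm series *)

Section Stirling.
Context {A : comUnitRingType}.
(** Assumed of a ring rather than of a field because (6) needs the case where [A] is itself a ring
    of power series, namely those in y. *)
Hypothesis natU : forall n, (n.+1%:R : A) \is a GRing.unit.
Implicit Types (c : A) (f g y z : {fps A}).

Lemma fact_unit n : (n`!%:R : A) \is a GRing.unit.
Proof.
elim: n => [|n IHn]; first exact: unitr1.
by rewrite factS natrM unitrM natU.
Qed.

Lemma factV_S n : ((n.+1)`!%:R)^-1 *+ n.+1 = (n`!%:R)^-1 :> A.
Proof.
by rewrite factS natrM invrM ?natU ?fact_unit // -[LHS]mulr_natr divrK ?natU.
Qed.

(** The equation in degree n gives n+1 times the coefficient of degree n+1 in terms of those of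
    degree at most n, and n+1 is invertible. *)
Lemma fps_linear_ode_unique g y z :
  fps_deriv y = g * y -> fps_deriv z = g * z -> fcoef y 0 = fcoef z 0 -> y = z.
Proof.
move=> Dy Dz yz0; apply: fpsP => n; elim/ltn_ind: n => -[//|n] IHn.
apply: (mulIr (natU n)); rewrite !mulr_natr -!fcoef_deriv Dy Dz !fcoefM.
by apply: eq_bigr => i _; rewrite IHn // ltnS leq_subr.
Qed.

Lemma fcoef0_exp f : fcoef (fps_exp f) 0 = 1.
Proof. by rewrite /= big_ord1 expr0 fcoef1 invr1 mulr1. Qed.

Lemma fps_deriv_exp f : fcoef f 0 = 0 ->
  fps_deriv (fps_exp f) = fps_deriv f * fps_exp f.
Proof.
move=> f0; rewrite fps_deriv_comp //; congr (_ * fps_comp _ _).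
by apply: fpsP => n; rewrite fcoef_deriv [LHS]factV_S.
Qed.

(** Both sides solve y' = (f+g)' y with constant term 1. *)
Lemma fps_expD f g : fcoef f 0 = 0 -> fcoef g 0 = 0 ->
  fps_exp (f + g) = fps_exp f * fps_exp g.
Proof.
move=> f0 g0; apply: (@fps_linear_ode_unique (fps_deriv (f + g))).
- by rewrite fps_deriv_exp // fcoefD f0 g0 addr0.
- by rewrite fps_derivM !fps_deriv_exp // fps_derivD; ring.
- by rewrite fcoef0M !fcoef0_exp mulr1.
Qed.

Lemma fps_exp0 : fps_exp (0 : {fps A}) = 1.
Proof.
apply: (@fps_linear_ode_unique 0); rewrite ?fcoef0_exp // ?mul0r ?fps_deriv1 //.
rewrite fps_deriv_exp // (_ : fps_deriv 0 = 0) ?mul0r //.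
by apply: fpsP => n; rewrite /= mul0rn.
Qed.

(** This turns the quotient in (6) into an exponential. *)
Lemma fps_expN f : fcoef f 0 = 0 -> fps_exp (- f) = (fps_exp f)^-1.
Proof.
move=> f0; have expNK : fps_exp (- f) * fps_exp f = 1.
  by rewrite -fps_expD ?addNr ?fps_exp0 // fcoefN f0 oppr0.
have expU : fps_exp f \is a GRing.unit by apply/unitrPr; exists (fps_exp (- f)); rewrite mulrC.
by apply: (mulIr expU); rewrite expNK mulVr.
Qed.

Lemma fcoef_expCX c n : fcoef (fps_exp (fpsC c * fpsX)) n = c ^+ n / n`!%:R.
Proof. exact: fcoef_comp_CX. Qed.

Lemma fcoef0_CX c : fcoef (fpsC c * fpsX) 0 = 0.
Proof. by rewrite fcoefCM mulr0. Qed.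

Lemma fps_expCX_exp c i : fps_exp (fpsC c * fpsX) ^+ i = fps_exp (fpsC (c *+ i) * fpsX).
Proof.
elim: i => [|i IHi]; first by rewrite expr0 mulr0n rmorph0 mul0r fps_exp0.
by rewrite mulrS fpsCD mulrDl fps_expD ?fcoef0_CX -?IHi -?exprS.
Qed.

Lemma fcoef_XM f n : fcoef (fpsX * f) n = if n is p.+1 then fcoef f p else 0.
Proof.
case: n => [|n]; first by rewrite fcoef0M mul0r.
rewrite fcoefM big_ord_recl mul0r add0r big_ord_recl /= big1 => [|i _]; last by rewrite mul0r.
by rewrite mul1r addr0 /bump /= subSS subn0.
Qed.

Lemma fpsX_CX : fpsX = fpsC 1 * fpsX :> {fps A}.
Proof. by rewrite rmorph1 mul1r. Qed.

Lemma fcoef_ln1pCX c n : fcoef (fps_ln1p (fpsC c * fpsX)) n =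
  c ^+ n * (if n == 0%N then 0 else (-1) ^+ n.-1 / n%:R).
Proof. exact: fcoef_comp_CX. Qed.

Lemma fcoef_ln1pX n : fcoef (fps_ln1p fpsX) n =
  (if n == 0%N then 0 else (-1) ^+ n.-1 / n%:R) :> A.
Proof. by rewrite fpsX_CX fcoef_ln1pCX expr1n mul1r. Qed.

(** The derivative has coefficients (-1)^n: it is the geometric series of 1/(1+x). *)
Lemma fps_deriv_ln1pX : (1 + fpsX) * fps_deriv (fps_ln1p fpsX) = 1 :> {fps A}.
Proof.
have DE n : fcoef (fps_deriv (fps_ln1p fpsX)) n = (-1) ^+ n :> A.
  by rewrite fcoef_deriv fcoef_ln1pX -[LHS]mulr_natr divrK.
apply: fpsP => n; rewrite mulrDl mul1r fcoefD fcoef_XM fcoef1 !DE.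
by case: n => [|n]; rewrite ?addr0 // DE exprS mulN1r addNr.
Qed.

(** * Recurrences of the Stirling and r-Stirling numbers *)

Lemma stirling1_0 i : stirling1 0 i = (i == 0%N)%:R :> A.
Proof.
rewrite /stirling1 mul1r fcoefCM fcoef0X fcoef_ln1pX.
by case: i => [|i]; rewrite ?expr0n ?mulr0 // mulr1 invr1.
Qed.

Lemma stirling1_n0 n : stirling1 n.+1 0 = 0 :> A.
Proof. by rewrite /stirling1 fcoefCM expr0 fcoef1 !mulr0. Qed.

Lemma stirling1_small n i : (n < i)%N -> stirling1 n i = 0 :> A.
Proof.
by move=> ltni; rewrite /stirling1 fcoefCM fcoefX_lt ?mulr0 // fcoef_ln1pX.
Qed.

(* Coefficientwise form of (1 + x) E_{i+1}' = E_i for E_i = ln(1 + x)^i / i!. *)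
Lemma stirling1SS n i :
  stirling1 n.+1 i.+1 = stirling1 n i - n%:R * stirling1 n i.+1 :> A.
Proof.
pose E j : {fps A} := fpsC (j`!%:R)^-1 * fps_ln1p fpsX ^+ j.
have DE : (1 + fpsX) * fps_deriv (E i.+1) = E i.
  rewrite fps_derivCM fps_derivX /E -(factV_S i) -[_^-1 *+ _]mulr_natl.
  rewrite fpsCM fpsC_nat -[_ *+ i.+1]mulr_natl -[RHS]mulr1 -[X in _ = _ * X]fps_deriv_ln1pX.
  by ring.
have /(congr1 (fun x => n`!%:R * x)) := congr1 (fun h => fcoef h n) DE.
rewrite /stirling1 -![fpsC _ * _]/(E _) => <-.
rewrite mulrDl mul1r fcoefD fcoef_XM fcoef_deriv -[_ *+ n.+1]mulr_natl factS natrM.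
case: n => [|n]; first by rewrite addr0; ring.
by rewrite fcoef_deriv -[_ *+ n.+1]mulr_natl; ring.
Qed.

Lemma stirling1_sumS (g : nat -> A) n :
  \sum_(i < n.+2) stirling1 n.+1 i * g i =
  \sum_(i < n.+1) stirling1 n i * g i.+1
  - n%:R * \sum_(i < n.+1) stirling1 n i * g i.
Proof.
rewrite big_ord_recl stirling1_n0 mul0r add0r.
under eq_bigr do rewrite stirling1SS mulrBl -(mulrA n%:R).
rewrite sumrB -[X in _ - X]mulr_sumr; congr (_ - _).
(* The two sums multiplied by n differ by a shift of index: for n > 0 the extra terms s(n,n+1) and
   s(n,0) vanish, and for n = 0 the factor n does. *)
case: n => [|n]; first by rewrite !mul0r.
rewrite big_ord_recr /= stirling1_small // mul0r addr0.
by rewrite [in RHS]big_ord_recl stirling1_n0 mul0r add0r.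
Qed.

Lemma rstirling2_0 r i : rstirling2 r 0 i = (i == 0%N)%:R :> A.
Proof.
rewrite /rstirling2 mul1r fcoefCM fcoef0M fcoef0X fcoefD fcoefN fcoef0_exp fcoef1.
by rewrite fcoef0_exp subrr; case: i => [|i]; rewrite ?expr0n ?mulr0 // !mulr1 invr1.
Qed.

(** Differentiating an exponential generating function moves its index by one. *)
Lemma rstirling2_deriv r n i : rstirling2 r n.+1 i = n`!%:R *
  fcoef (fps_deriv (fpsC (i`!%:R)^-1 *
     (fps_exp (fpsC r%:R * fpsX) * (fps_exp fpsX - 1) ^+ i))) n :> A.
Proof. by rewrite fcoef_deriv /rstirling2 -[_ *+ n.+1]mulr_natl factS natrM; ring. Qed.

Lemma fps_deriv_expCX c :
  fps_deriv (fps_exp (fpsC c * fpsX)) = fpsC c * fps_exp (fpsC c * fpsX).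
Proof.
rewrite fps_deriv_exp ?fcoef0_CX // fps_derivCM (_ : fps_deriv fpsX = 1) ?mulr1 //.
by apply: fpsP => n; rewrite fcoef_deriv fcoef1; case: n => [|n]; rewrite ?mul0rn.
Qed.

Lemma rstirling2_n0 r n : rstirling2 r n.+1 0 = r%:R * rstirling2 r n 0 :> A.
Proof.
rewrite rstirling2_deriv expr0 mulr1 fps_derivCM fps_deriv_expCX mulrCA fcoefCM.
by rewrite /rstirling2 expr0 mulr1 mulrCA.
Qed.

(** With u = e^z - 1 and e = e^(rz), one has u' = u + 1 and e' = r e. In the derivative of e
    u^(i+1)/(i+1)!, the summand u of u' contributes i+1 to the weight and the summand 1 lowers the
    power of u. *)
Lemma rstirling2SS r n i : rstirling2 r n.+1 i.+1 =
  (r + i.+1)%:R * rstirling2 r n i.+1 + rstirling2 r n i :> A.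
Proof.
set u := fps_exp fpsX - 1 : {fps A}; set e := fps_exp (fpsC r%:R * fpsX) : {fps A}.
have Du : fps_deriv u = u + 1.
  have -> : fps_deriv u = fps_deriv (u + 1) by rewrite [RHS]fps_derivD fps_deriv1 addr0.
  by rewrite subrK fpsX_CX fps_deriv_expCX rmorph1 !mul1r.
have De : fps_deriv e = fpsC r%:R * e by exact: fps_deriv_expCX.
have DG : fps_deriv (fpsC (i.+1`!%:R)^-1 * (e * u ^+ i.+1)) =
    fpsC (r + i.+1)%:R * (fpsC (i.+1`!%:R)^-1 * (e * u ^+ i.+1))
    + fpsC (i`!%:R)^-1 * (e * u ^+ i).
  rewrite fps_derivCM fps_derivM De fps_derivX Du -(factV_S i).
  rewrite -[_^-1 *+ _]mulr_natl -[_ *+ i.+1]mulr_natl fpsCM natrD fpsCD !fpsC_nat.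
  by rewrite exprS; ring.
by rewrite rstirling2_deriv DG fcoefD fcoefCM /rstirling2 -/e -/u mulrDr mulrCA.
Qed.

Lemma rstirling2_small r n i : (n < i)%N -> rstirling2 r n i = 0 :> A.
Proof.
elim: n i => [|n IHn] [|i] // ltni; first by rewrite rstirling2_0.
by rewrite rstirling2SS !IHn ?mulr0 ?addr0 // ltnW.
Qed.

Lemma rstirling2_sum (g : nat -> A) n m :
  \sum_(i < n.+1) stirling1 n i * g (i + m)%N =
  \sum_(j < m.+1) rstirling2 n m j *
    \sum_(i < (n + j).+1) stirling1 (n + j) i * g i.
Proof.
elim: m g => [|m IHm] g.
  by rewrite big_ord1 rstirling2_0 mul1r addn0; apply: eq_bigr => i _; rewrite addn0.
pose S j := \sum_(i < (n + j).+1) stirling1 (n + j) i * g i.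
under eq_bigr do rewrite addnS.
(* The induction hypothesis is taken at the shifted sequence, which is why [g] is kept general. *)
rewrite (IHm (fun i => g i.+1)).
transitivity (\sum_(j < m.+1) rstirling2 n m j * (S j.+1 + (n + j)%:R * S j)).
  by apply: eq_bigr => j _; rewrite /S addnS stirling1_sumS subrK.
under eq_bigr do rewrite mulrDr.
rewrite big_split [RHS]big_ord_recl rstirling2_n0 -/(S _) /=.
under [in RHS]eq_bigr do rewrite rstirling2SS -/(S _) mulrDl.
rewrite big_split addrA [RHS]addrC; congr (_ + _).
(* The weighted sum has no term j = m+1, as {m+n, m+1+n}_n = 0; its term j = 0 is the one that
   [rstirling2_n0] produced. *)
rewrite [in RHS]big_ord_recr (rstirling2_small n m m.+1) //= mulr0 mul0r addr0 big_ord_recl addn0.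
by congr (_ + _); [rewrite mulrCA mulrA | apply: eq_bigr => i _; rewrite mulrCA mulrA].
Qed.

(** The definition of s(n,i) with c x substituted for x. *)
Lemma fcoef_ln1pCX_exp c i n :
  fcoef (fps_ln1p (fpsC c * fpsX) ^+ i) n =
  c ^+ n * (i`!%:R * stirling1 n i / n`!%:R).
Proof.
rewrite (@fcoef_scaleX _ (fps_ln1p fpsX) _ c) => [|k]; last first.
  by rewrite fcoef_ln1pCX fcoef_ln1pX.
rewrite /stirling1 fcoefCM [X in _ * (X / _)]mulrCA.
by rewrite mulVKr ?fact_unit // (mulrC n`!%:R) mulrK ?fact_unit.
Qed.

Lemma fps_natU n : (n.+1%:R : {fps A}) \is a GRing.unit.
Proof. by rewrite -fpsC_nat rmorph_unit. Qed.
End Stirling.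

(** The same recurrence holds over both rings. In (6) the outer series has coefficients in the ring
    of series in y, where the Stirling numbers must be recognized as constants. *)
Lemma stirling1_fpsC {A : comUnitRingType}
    (natU : forall n, (n.+1%:R : A) \is a GRing.unit) n i :
  stirling1 n i = fpsC (stirling1 n i) :> {fps A}.
Proof.
have natU' := fps_natU natU.
elim: n i => [|n IHn] i; first by rewrite !stirling1_0 fpsC_nat.
case: i => [|i]; first by rewrite !stirling1_n0 rmorph0.
by rewrite !stirling1SS // !IHn -(fpsC_nat n) -fpsCM -rmorphB.
Qed.

(** * The sums Λ_n for the poly-Cauchy sequence *)

(* [rcpow l a] enters only as a constant factor [r], so the identities
   hold over any [numFieldType]. *)
Section PolyCauchyField.
Context {F : numFieldType}.
Implicit Types (k : int) (r a q l : F).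

(** Multiplied by (-l/q)^m, this is Λ_n of the m-th shift of g, with [r] for l^a. *)
Definition cauchy2_sum k r a q l n m : F :=
  \sum_(i < n.+1) stirling1 n i * (r * (- l / q) ^+ i / (a + i%:R + m%:R) ^ k).

Lemma natF_unit n : (n.+1%:R : F) \is a GRing.unit.
Proof. by rewrite unitfE pnatr_eq0. Qed.

Lemma cauchy2_termE q l (s r d : F) n i : q != 0 -> (i <= n)%N ->
  q ^+ (n - i) * s * ((-1) ^+ i * (r * l ^+ i) / d) =
  q ^+ n * (s * (r * (- l / q) ^+ i / d)).
Proof.
move=> q0 lein; have qi0 : q ^+ i != 0 by rewrite expf_neq0.
rewrite -{2}(subnK lein) exprD expr_div_n (exprNn l).
(* The factor q^i / q^i is inserted so that the remaining identity requires no cancellation. *)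
transitivity ((q ^+ i / q ^+ i) * (q ^+ (n - i) * s * ((-1) ^+ i * (r * l ^+ i) / d))).
  by rewrite divff // mul1r.
by ring.
Qed.

Lemma cauchy2_sumE k r a q l n m : q != 0 ->
  \sum_(i < n.+1) q ^+ (n - i) * stirling1 n i *
    ((-1) ^+ i * (r * l ^+ i) / (a + i%:R + m%:R) ^ k) =
  q ^+ n * cauchy2_sum k r a q l n m.
Proof.
move=> q0; rewrite mulr_sumr; apply: eq_bigr => i _.
by rewrite cauchy2_termE // -ltnS.
Qed.

(** Passing from i to i+1 costs a factor -l/q and, in the denominator, amounts to passing from m to
    m+1. *)
Lemma cauchy2_sum_shift k r a q l n m :
  \sum_(i < n.+1) stirling1 n i *
    (r * (- l / q) ^+ i.+1 / (a + i.+1%:R + m%:R) ^ k) =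
  - l / q * cauchy2_sum k r a q l n m.+1.
Proof.
rewrite mulr_sumr; apply: eq_bigr => i _.
have -> : a + i.+1%:R + m%:R = a + i%:R + m.+1%:R by rewrite -!natr1; ring.
by rewrite exprS; ring.
Qed.

Lemma cauchy2_sumS k r a q l n m : cauchy2_sum k r a q l n.+1 m =
  - l / q * cauchy2_sum k r a q l n m.+1 - n%:R * cauchy2_sum k r a q l n m.
Proof.
rewrite -cauchy2_sum_shift.
exact: (stirling1_sumS natF_unit (fun i => r * (- l / q) ^+ i / (a + i%:R + m%:R) ^ k)).
Qed.

Lemma cauchy2_sum_rstirling2 k r a q l n m :
  (- l / q) ^+ m * cauchy2_sum k r a q l n m =
  \sum_(j < m.+1) rstirling2 n m j * cauchy2_sum k r a q l (n + j) 0.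
Proof.
rewrite -(rstirling2_sum natF_unit
  (fun i => r * (- l / q) ^+ i / (a + i%:R + 0%:R) ^ k)).
rewrite mulr_sumr; apply: eq_bigr => i _.
by rewrite natrD addr0 addrA exprD; ring.
Qed.

(** The 1/i! of [Lif] cancels the i! in the expansion of the i-th power of ln(1+qx), leaving
    s(N,i). *)
Lemma fcoef_Lif_ln1p k a q l N m :
  fcoef (Lif k (a + m%:R) (fpsC (- l / q) * fps_ln1p (fpsC q * fpsX))) N =
  q ^+ N * cauchy2_sum k 1 a q l N m / N`!%:R.
Proof.
rewrite [LHS]/= mulr_sumr mulr_suml; apply: eq_bigr => i _.
rewrite exprMn -rmorphXn fcoefCM (fcoef_ln1pCX_exp natF_unit).
have fact0 : i`!%:R != 0 :> F by rewrite -unitfE (fact_unit natF_unit).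
have -> : i%:R + (a + m%:R) = a + i%:R + m%:R by ring.
rewrite -[RHS]mul1r -[X in _ = X * _](divff fact0).
by ring.
Qed.

Lemma fpsC_natV n : (n`!%:R)^-1 = fpsC (n`!%:R)^-1 :> {fps F}.
Proof. by rewrite rmorphV ?(fact_unit natF_unit) // rmorph_nat. Qed.

(** The x^N-coefficient of (1+qx)^(-(l/q) e^(by)) is a combination of the e^(biy) with i <= N.
    Multiplied by r e^(ay), these become r e^((a+bi)y), whose coefficients in y are powers of
    a+bi. *)
Lemma fcoef_cauchy2_gf r a q l (b : F) (N k : nat) :
  fcoef (fcoef (fpsC (fpsC r * fps_exp (fpsC a * fpsX)) /
    fps_pow1p (fpsC (fpsC q) * fpsX)
      (fpsC (l / q) * fps_exp (fpsC b * fpsX))) N) k =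
  q ^+ N * (\sum_(i < N.+1) stirling1 N i * (r * (- l / q) ^+ i * (a + b *+ i) ^+ k))
    / N`!%:R / k`!%:R.
Proof.
have natU := fps_natU natF_unit.
rewrite /fps_pow1p; set e := fpsC (l / q) * _; set Ln := fps_ln1p _.
have Ln0 : fcoef Ln 0 = 0 by rewrite fcoef_ln1pCX mulr0.
rewrite -(fps_expN natU); last by rewrite fcoef0M Ln0 mulr0.
rewrite fcoefCM.
have -> : fcoef (fps_exp (- (fpsC e * Ln))) N =
  \sum_(i < N.+1) fpsC (q ^+ N * (- l / q) ^+ i * stirling1 N i / N`!%:R)
     * fps_exp (fpsC (b *+ i) * fpsX).
  apply: eq_bigr => i _; rewrite -mulNr -rmorphN exprMn -rmorphXn fcoefCM.
  rewrite (fcoef_ln1pCX_exp natU) (stirling1_fpsC natF_unit) [fcoef _ i]/= !fpsC_natV.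
  have -> : - e = fpsC (- l / q) * fps_exp (fpsC b * fpsX).
    by rewrite mulNr rmorphN [RHS]mulNr.
  rewrite exprMn -rmorphXn (fps_expCX_exp natF_unit) -[fpsC q ^+ N]rmorphXn.
  have iV : fpsC (i`!%:R)^-1 * i`!%:R = 1 :> {fps F}.
    by rewrite -fpsC_nat -fpsCM mulVf ?rmorph1 // -unitfE (fact_unit natF_unit).
  rewrite !fpsCM -[RHS]mul1r -[X in _ = X * _]iV /=.
  by ring.
rewrite mulr_sumr fcoef_sum mulr_sumr !mulr_suml; apply: eq_bigr => i _.
rewrite mulrACA -(fps_expD natF_unit) ?fcoef0_CX // -mulrDl -fpsCD -fpsCM.
by rewrite fcoefCM fcoef_expCX; ring.
Qed.

(** * The identities for the poly-Cauchy numbers over a field *)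

Definition gpcauchy2 k r a q l n : F :=
  \sum_(i < n.+1) stirling1 n i * (-1) ^+ i *
    (q ^+ (n - i) * (r * l ^+ i) / (a + i%:R) ^ k).

Definition gmpcauchy2 k r a q l n m : F :=
  (a + m%:R) ^ k / a ^ k *
  \sum_(i < n.+1) q ^+ (n - i) * stirling1 n i *
    ((-1) ^+ i * (r * l ^+ i) / (a + i%:R + m%:R) ^ k).

Lemma gmpcauchy2E k r a q l n m : q != 0 ->
  gmpcauchy2 k r a q l n m =
  (a + m%:R) ^ k / a ^ k * (q ^+ n * cauchy2_sum k r a q l n m).
Proof. by move=> q0; rewrite -cauchy2_sumE. Qed.

Lemma gpcauchy2E k r a q l n : q != 0 ->
  gpcauchy2 k r a q l n = q ^+ n * cauchy2_sum k r a q l n 0.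
Proof.
move=> q0; rewrite -cauchy2_sumE //; apply: eq_bigr => i _.
by rewrite addr0; ring.
Qed.

Lemma gmpcauchy2_0 k r a q l m : a + m%:R != 0 ->
  gmpcauchy2 k r a q l 0 m = r / a ^ k.
Proof.
move=> am0; rewrite /gmpcauchy2 big_ord1 stirling1_0 !expr0 !mul1r mulr1 addr0.
by rewrite mulrAC mulrCA divff ?mulr1 // expfz_neq0.
Qed.

Lemma gmpcauchy2_gf k r a q l m : q != 0 ->
  fpsC (r * (a + m%:R) ^ k / a ^ k) *
    Lif k (a + m%:R) (fpsC (- l / q) * fps_ln1p (fpsC q * fpsX)) =
  \fps_N (gmpcauchy2 k r a q l N m / N`!%:R).
Proof.
move=> q0; apply: fpsP => N; rewrite fcoefCM fcoef_Lif_ln1p [RHS]/= gmpcauchy2E //.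
have -> : cauchy2_sum k r a q l N m = r * cauchy2_sum k 1 a q l N m.
  by rewrite mulr_sumr; apply: eq_bigr => i _; ring.
by ring.
Qed.

(** Common form of (4) and (5), for [k] of either sign. The ratio to the power [k] compensates the
    change of the prefactor (a+m)^k/a^k when m becomes m+1. *)
Lemma gmpcauchy2S k r a q l n m : q != 0 -> (forall j : nat, a + j%:R != 0) ->
  gmpcauchy2 k r a q l n.+1 m =
  - l * ((a + m%:R) / (a + m%:R + 1)) ^ k * gmpcauchy2 k r a q l n m.+1
  - n%:R * q * gmpcauchy2 k r a q l n m.
Proof.
move=> q0 a0; rewrite !gmpcauchy2E // cauchy2_sumS expfzMl exprz_inv -invr_expz.
have -> : a + m%:R + 1 = a + m.+1%:R by rewrite -natr1 addrA.
set V := (a + m.+1%:R) ^ k; have V0 : V != 0 by rewrite expfz_neq0.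
set W := a ^ k; have W0 : W != 0 by rewrite expfz_neq0 // -[a]addr0 (a0 0%N).
by rewrite exprS; field; rewrite V0 W0 q0.
Qed.

Lemma gmpcauchy2_rstirling2 k r a q l n m : q != 0 -> l != 0 ->
  gmpcauchy2 k r a q l n m =
  (- q) ^+ m * (a + m%:R) ^ k / (l ^+ m * a ^ k) *
    \sum_(j < m.+1) q ^- j * rstirling2 n m j * gpcauchy2 k r a q l (n + j).
Proof.
move=> q0 l0; rewrite gmpcauchy2E //.
(* The factor q^(-j) reduces the q^(n+j) of each number to q^n, common to all j. *)
have -> : \sum_(j < m.+1) q ^- j * rstirling2 n m j * gpcauchy2 k r a q l (n + j) =
    q ^+ n * ((- l / q) ^+ m * cauchy2_sum k r a q l n m).
  rewrite cauchy2_sum_rstirling2 mulr_sumr; apply: eq_bigr => j _.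
  rewrite gpcauchy2E // exprD -[RHS]mul1r.
  by rewrite -[X in _ = X * _](divff (expf_neq0 j q0)); ring.
set S := cauchy2_sum _ _ _ _ _ _ _.
(* The prefactor (-q)^m removes the (-l/q)^m of the shifted sum up to l^m, which the denominator
   cancels. *)
have qlm : (- q) ^+ m * (- l / q) ^+ m = l ^+ m.
  by rewrite -exprMn; congr (_ ^+ m); rewrite mulrA mulrNN mulrC mulKf.
rewrite -[LHS]mul1r -[X in X * _ = _](divff (expf_neq0 m l0)) -[X in X / _ * _ = _]qlm.
by rewrite invfM; ring.
Qed.

Lemma gmpcauchy2_neg_gf r a q l m : q != 0 -> a + m%:R != 0 ->
  \fps_N \fps_k (gmpcauchy2 (- k%:Z) r a q l N m / N`!%:R / k`!%:R) =
  fpsC (fpsC r * fps_exp (fpsC a * fpsX)) /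
    fps_pow1p (fpsC (fpsC q) * fpsX)
      (fpsC (l / q) * fps_exp (fpsC (a / (a + m%:R)) * fpsX)).
Proof.
move=> q0 am0; apply: fpsP => N; apply: fpsP => k.
rewrite fcoef_cauchy2_gf [LHS]/= gmpcauchy2E // mulrCA; congr (_ * _ / _ / _).
(* At exponent -k the prefactor is a^k/(a+m)^k and (a+i+m)^k stands in the numerator, so each term
   carries a full k-th power. *)
rewrite mulr_sumr; apply: eq_bigr => i _; rewrite -!exprnN !invrK.
have -> : a + a / (a + m%:R) *+ i = a * (a + i%:R + m%:R) / (a + m%:R).
  by rewrite -[_ *+ i]mulr_natr; field.
by rewrite (expr_div_n (a * _)) (exprMn k a); ring.
Qed.
End PolyCauchyField.

(** * Specialization to complex values, with r = l^a *)

Theorem theorem4 (R : realType) (a q l : R) (L : seq R) (n m : nat)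
    (a_neq0 : a != 0) (q_neq0 : q != 0)
    (L_neq0 : forall x, x \in L -> x != 0)
    (lE : l = \prod_(x <- L) x)
    (a_den : forall j : nat, a + j%:R != 0) :
  (forall k : nat, (1 <= k)%N ->
    [/\ fpsC (rcpow l a * (a%:C + m%:R) ^+ k / a%:C ^+ k) *
          Lif k (a%:C + m%:R)
            (fpsC (- l%:C / q%:C) * fps_ln1p (fpsC q%:C * fpsX))
        = \fps_N (mpcauchy2 k a q L N m / N`!%:R),
        mpcauchy2 k a q L n m
        = (a%:C + m%:R) ^+ k / a%:C ^+ k *
          \sum_(i < n.+1) q%:C ^+ (n - i) * stirling1 n i *
            ((-1) ^+ i * lpow l a i / (a%:C + i%:R + m%:R) ^+ k),
        mpcauchy2 k a q L n m
        = (- q%:C) ^+ m * (a%:C + m%:R) ^+ k / (l%:C ^+ m * a%:C ^+ k) *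
          \sum_(j < m.+1) q%:C ^- j * rstirling2 n m j *
            pcauchy2 k a q L (n + j),
        mpcauchy2 k a q L n.+1 m
        = - l%:C * (1 - 1 / (a%:C + m%:R + 1)) ^+ k *
            mpcauchy2 k a q L n m.+1
          - n%:R * q%:C * mpcauchy2 k a q L n m
      & mpcauchy2 k a q L 0 m = rcpow l a / a%:C ^+ k])
  /\
  (forall k : nat,
    mpcauchy2 (- k%:Z) a q L n.+1 m
    = - l%:C * (1 + 1 / (a%:C + m%:R)) ^+ k *
        mpcauchy2 (- k%:Z) a q L n m.+1
      - n%:R * q%:C * mpcauchy2 (- k%:Z) a q L n m
    /\ mpcauchy2 (- k%:Z) a q L 0 m = a%:C ^+ k * rcpow l a)
  /\
  \fps_N \fps_k (mpcauchy2 (- k%:Z) a q L N m / N`!%:R / k`!%:R)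
  = fpsC (fpsC (rcpow l a) * fps_exp (fpsC a%:C * fpsX)) /
    fps_pow1p (fpsC (fpsC q%:C) * fpsX)
      (fpsC (l%:C / q%:C) * fps_exp (fpsC (a%:C / (a%:C + m%:R)) * fpsX)).
Proof.
have l0 : l%:C != 0.
  rewrite fmorph_eq0 lE prodf_seq_neq0; apply/allP => x xL.
  by apply/implyP => _; exact: L_neq0.
have q0 : q%:C != 0 by rewrite fmorph_eq0.
have aj0 j : a%:C + j%:R != 0 by rewrite -(rmorph_nat (real_complex R)) -rmorphD fmorph_eq0.
(* Once l is the product of [L], both sides unfold to the same expression. *)
have mE k N p : mpcauchy2 k a q L N p = gmpcauchy2 k (rcpow l a) a%:C q%:C l%:C N p.
  by rewrite lE.
have pE k N : pcauchy2 k a q L N = gpcauchy2 k (rcpow l a) a%:C q%:C l%:C N.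
  by rewrite lE.
split; [move=> k k1 | split; [move=> k|]].
- split.
  + rewrite (gmpcauchy2_gf k); last exact: q0.
    by apply: fpsP => N; rewrite [RHS]/= mE.
  + by rewrite mE.
  + rewrite mE (@gmpcauchy2_rstirling2 _ k _ _ _ _ n m q0 l0).
    by congr (_ * _); apply: eq_bigr => j _; rewrite pE.
  + rewrite !mE gmpcauchy2S //.
    have -> // : 1 - 1 / (a%:C + m%:R + 1) = (a%:C + m%:R) / (a%:C + m%:R + 1).
    have am1 : a%:C + m%:R + 1 != 0 by rewrite -addrA natr1 aj0.
    by rewrite -[X in X - _](divff am1) -mulrBl addrK.
  + by rewrite mE gmpcauchy2_0.
- split; last by rewrite mE gmpcauchy2_0 // -exprnN invrK mulrC.
  (* This is the inverse of the ratio in [gmpcauchy2S], where the exponent is -k. *)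
  have -> : 1 + 1 / (a%:C + m%:R) = (a%:C + m%:R + 1) / (a%:C + m%:R).
    by rewrite [RHS]mulrDl divff.
  by rewrite !mE gmpcauchy2S // -exprnN -exprVn invf_div.
- apply: etrans (gmpcauchy2_neg_gf (rcpow l a) a%:C q%:C l%:C m q0 (aj0 m)).
  by apply: fpsP => N; apply: fpsP => k; rewrite [LHS]/= mE.
Qed.
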